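(* For every positive integer $r$, $$s(r+1,r)\ge\frac1r.$$
   Context: Let $r<k$ be positive integers and $X$ a set. A sequence $x\in X^r$ covers a sequence $a\in X^k$ if $x$ is a (not necessarily contiguous) subsequence of $a$, i.e., $x$ is obtained from $a$ by removing $k-r$ entries while keeping the order of the remaining entries. A set $C\subseteq X^r$ covering $X^k$ (i.e., such that every sequence in $X^k$ is covered by at least one sequence in $C$) is called a covering $(k-r)$-insertion code over $X$. Write $[n]=\{0,1,\ldots,n-1\}$. $S(n,k,r)$ denotes the minimum cardinality of a covering $(k-r)$-insertion code $C\subseteq[n]^r$ over $[n]$, and $s(k,r)=\lim_{n\to\infty}S(n,k,r)/n^r$ (this limit exists). *)

(* Defs.v *)
From mathcomp Require Import all_boot all_order all_algebra.
From mathcomp Require Import all_classical all_reals all_analysis.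

Set Implicit Arguments.
Unset Strict Implicit.
Unset Printing Implicit Defensive.

Import Order.TTheory GRing.Theory Num.Theory.
Import numFieldNormedType.Exports.

Local Open Scope ring_scope.

(* [subseq x a] is the not necessarily contiguous subsequence relation. *)
Definition covers (X : eqType) (r k : nat) (x : r.-tuple X) (a : k.-tuple X) :
  bool := subseq x a.

Definition covering_insertion_code (X : finType) (k r : nat)
  (C : {set r.-tuple X}) : bool :=
  [forall a : k.-tuple X, [exists x in C, covers x a]].

(* The alphabet [n] = {0, ..., n-1} is 'I_n.  The set of all r-tuples is a
   covering code as soon as r <= k; for r > k the value is irrelevant. *)
Definition min_code_size (n k r : nat) : nat :=
  #|[arg min_(C < [set: r.-tuple 'I_n] | covering_insertion_code k C) #|C| ]|.

Lemma covering_setT (X : finType) (k r : nat) :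
  (r <= k)%N -> covering_insertion_code k [set: r.-tuple X].
Proof.
move=> rk; apply/forallP => a; apply/existsP.
have sz : size (take r a) == r by rewrite size_takel ?size_tuple.
by exists (Tuple sz); rewrite finset.in_setT /= /covers /= take_subseq.
Qed.

Lemma min_code_sizeP (n k r : nat) : (r <= k)%N ->
  (exists2 C : {set r.-tuple 'I_n},
     covering_insertion_code k C & #|C| = min_code_size n k r) /\
  (forall C : {set r.-tuple 'I_n},
     covering_insertion_code k C -> (min_code_size n k r <= #|C|)%N).
Proof.
move=> rk; rewrite /min_code_size.
by case: arg_minnP => [|C0 hC0 min0]; [exact: covering_setT | split; [exists C0|]].
Qed.

(* [limn] of a divergent sequence of reals is the default value 0, so a
   positive lower bound on [code_density] entails that the limit exists. *)
Definition code_density (R : realType) (k r : nat) : R :=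
  limn (fun n : nat => (min_code_size n k r)%:R / n%:R ^+ r : R).

(* Main.v *)
Require Import Defs.
From mathcomp Require Import all_boot all_order all_algebra.
From mathcomp Require Import all_classical all_reals all_analysis.
From mathcomp Require Import zify ring lra.

Import Order.TTheory GRing.Theory Num.Theory.
Import numFieldNormedType.Exports.

Local Open Scope ring_scope.

(** Lower bound.  Let [C] be a covering code of words of length [r] over an
alphabet [X] with [q] letters, all words of length [r + 1] being covered, and
let [F] be its complement.  For a word [a] of length [r + 1], let [w a] be the
number of positions whose deletion turns [a] into a word of [F].  Since [a] is
covered, [w a <= r], hence [w a ^+ 2 <= r * w a].  Sum this over all [a].

- Each word of length [r] arises [(r + 1) * q] times by deleting a letter, so
  the sum of the [w a] is [(r + 1) * q * #|F|].
- The sum of the [w a ^+ 2] counts triples [(a, j, j')] with both deletions in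
  [F].  If [j = j'] they contribute [(r + 1) * q * #|F|] again.  Otherwise the
  two deletions arise from the word [s] of length [r - 1] that lacks both
  letters, each by inserting one letter.  If [d_p s] is the number of letters
  whose insertion at position [p] of [s] gives a word of [F], the off-diagonal
  contribution is the sum over [s] of [(\sum_p d_p s) ^+ 2 + \sum_p d_p s ^+ 2].
  By Cauchy-Schwarz, over [p] and then over [s], it is at least
  [r * (r + 1) * #|F| ^+ 2 / q ^+ (r - 1)].

This gives [#|F| <= (1 - 1 / r) * q ^+ r], that is [q ^+ r <= r * #|C|]
([card_covering_ge], where [r = m + 1]).  It is the analogue for words of de Caen's bound on
Turan numbers, and it holds for every [q], without error term.

Existence of the limit.  Splitting each of [n] letters into at most [t] copies
turns a code over [n] letters into one over [N <= n * t] letters, larger by a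
factor of at most [t ^ r] ([min_code_size_blowup]).  With [t <= N / n + 1], the
densities satisfy [u_N <= u_n * (1 + n / N) ^+ r] for positive [n] and [N], and
such a nonnegative sequence converges to its infimum over positive indices
([cvg_of_blowup_bound]).  The limit inherits the lower bound [1 / r]. *)

(** * Deleting and inserting one letter *)

(** The word [a] without its letter at position [i]. *)
Definition del_tuple {X : Type} {m : nat} (i : 'I_m.+1) (a : m.+1.-tuple X) :
  m.-tuple X := [tuple tnth a (lift i t) | t < m].

(** The word obtained from [s] by inserting the letter [u], which ends up at
position [i]. *)
Definition ins_tuple {X : Type} {m : nat} (i : 'I_m.+1) (u : X)
  (s : m.-tuple X) : m.+1.-tuple X :=
  [tuple if unlift i t is Some t' then tnth s t' else u | t < m.+1].

Lemma tnth_ins_at {X : Type} {m : nat} (i : 'I_m.+1) (u : X)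
  (s : m.-tuple X) : tnth (ins_tuple i u s) i = u.
Proof. by rewrite tnth_mktuple unlift_none. Qed.

Lemma tnth_ins_lift {X : Type} {m : nat} (i : 'I_m.+1) (u : X)
  (s : m.-tuple X) (t : 'I_m) : tnth (ins_tuple i u s) (lift i t) = tnth s t.
Proof. by rewrite tnth_mktuple liftK. Qed.

Lemma ins_tupleK {X : Type} {m : nat} (i : 'I_m.+1) (u : X) :
  cancel (ins_tuple (m := m) i u) (del_tuple i).
Proof.
by move=> s; apply: eq_from_tnth => t; rewrite tnth_mktuple tnth_ins_lift.
Qed.

Lemma del_tupleK {X : Type} {m : nat} (i : 'I_m.+1) (a : m.+1.-tuple X) :
  ins_tuple i (tnth a i) (del_tuple i a) = a.
Proof.
apply: eq_from_tnth => t; case: (unliftP i t) => [t'|] ->.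
  by rewrite tnth_ins_lift tnth_mktuple.
by rewrite tnth_ins_at.
Qed.

(** For each fixed position, a word of length [m + 1] is uniquely a word of
length [m] with one letter inserted at that position. *)
Lemma sum_ins_tuple {R : nmodType} {X : finType} {m : nat} (i : 'I_m.+1)
  (G : m.+1.-tuple X -> R) :
  \sum_a G a = \sum_(s : m.-tuple X) \sum_(u : X) G (ins_tuple i u s).
Proof.
rewrite pair_big /=.
rewrite (reindex (fun p : m.-tuple X * X => ins_tuple i p.2 p.1)) //=.
exists (fun a => (del_tuple i a, tnth a i)) => [[s u] _|a _] /=.
  by rewrite ins_tupleK tnth_ins_at.
by rewrite del_tupleK.
Qed.

(** The index that position [j] acquires once position [lift j i], which is
distinct from [j], has been deleted.  The default value [i] is never used, by
[lift_exch]. *)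
Definition exch {m : nat} (j : 'I_m.+2) (i : 'I_m.+1) : 'I_m.+1 :=
  odflt i (unlift (lift j i) j).

Lemma lift_exch {m : nat} (j : 'I_m.+2) (i : 'I_m.+1) :
  lift (lift j i) (exch j i) = j.
Proof.
rewrite /exch; case: unliftP => [p /= <- //|/eqP].
by rewrite (negPf (neq_lift j i)).
Qed.

(** Both sides enumerate in increasing order the positions that are neither [j]
nor [lift j i]. *)
Lemma lift_lift_exch {m : nat} (j : 'I_m.+2) (i : 'I_m.+1) (t : 'I_m) :
  lift (lift j i) (lift (exch j i) t) = lift j (lift i t).
Proof.
have := congr1 val (lift_exch j i).
move=> /= E; apply: val_inj => /=; move: E; rewrite /bump; lia.
Qed.

Lemma exch_at {m : nat} (i : 'I_m.+1) : exch (widen_ord (leqnSn _) i) i = i.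
Proof.
have := congr1 val (lift_exch (widen_ord (leqnSn _) i) i).
move=> /= E; apply: val_inj => /=; move: E; rewrite /bump; lia.
Qed.

Lemma exch_lift {m : nat} (i p : 'I_m.+1) :
  exch (lift (widen_ord (leqnSn _) i) p) i = p.
Proof.
have := congr1 val (lift_exch (lift (widen_ord (leqnSn _) i) p) i).
move=> /= E; apply: val_inj => /=; move: E; rewrite /bump; lia.
Qed.

(** Inserting [u] and then [v], and deleting [u] again, amounts to inserting
[v] alone. *)
Lemma del_ins_ins {X : Type} {m : nat} (j : 'I_m.+2) (i : 'I_m.+1) (u v : X)
  (s : m.-tuple X) :
  del_tuple (lift j i) (ins_tuple j v (ins_tuple i u s)) =
  ins_tuple (exch j i) v s.
Proof.
apply: eq_from_tnth => t; rewrite tnth_mktuple.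
case: (unliftP (exch j i) t) => [t'|] ->.
  by rewrite lift_lift_exch !tnth_ins_lift.
by rewrite lift_exch !tnth_ins_at.
Qed.

(** * Double counting *)

(** The Cauchy-Schwarz inequality against the constant family [1]. *)
Lemma sqr_sum_le {R : realDomainType} {I : finType} (F : I -> R) :
  (\sum_i F i) ^+ 2 <= #|I|%:R * \sum_i F i ^+ 2.
Proof.
have : 0 <= \sum_i \sum_j (F i - F j) ^+ 2.
  by do 2!(apply: sumr_ge0 => ? _); exact: sqr_ge0.
suff -> : \sum_i \sum_j (F i - F j) ^+ 2 =
  2 * (#|I|%:R * \sum_i F i ^+ 2 - (\sum_i F i) ^+ 2).
  by rewrite pmulr_rge0 ?ltr0n// subr_ge0.
set S := \sum_i F i; set Q := \sum_i F i ^+ 2.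
transitivity (\sum_i (#|I|%:R * F i ^+ 2 - 2 * S * F i + Q)).
  apply: eq_bigr => i _.
  transitivity (\sum_j (F i ^+ 2 - 2 * F i * F j + F j ^+ 2)).
    by apply: eq_bigr => j _; ring.
  rewrite !big_split /= sumr_const sumrN -mulr_sumr -mulr_natl -/S -/Q; ring.
rewrite !big_split /= sumr_const sumrN -!mulr_sumr -mulr_natl -/S -/Q.
ring.
Qed.

(** For fixed [i], the index [exch j i] takes every value exactly once, except
the value [i], which it takes twice, for [j = i] and [j = i + 1]. *)
Lemma sum_exch {R : nmodType} {m : nat} (i : 'I_m.+1) (g : 'I_m.+1 -> R) :
  \sum_(j < m.+2) g (exch j i) = g i + \sum_p g p.
Proof.
rewrite (bigD1_ord (widen_ord (leqnSn _) i)) //= exch_at; congr (_ + _).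
by apply: eq_bigr => p _; rewrite exch_lift.
Qed.

(** The sum of [f] over the words obtained by inserting a letter at position
[p] of [s]; for the indicator function of a set, this is a degree of [s]. *)
Definition extension_sum {R : nmodType} {X : finType} {m : nat}
  (f : m.+1.-tuple X -> R) (p : 'I_m.+1) (s : m.-tuple X) : R :=
  \sum_u f (ins_tuple p u s).

(** The sum of [f] over the words obtained by deleting a letter of [a], counted
with multiplicity. *)
Definition deletion_sum {R : nmodType} {X : finType} {m : nat}
  (f : m.-tuple X -> R) (a : m.+1.-tuple X) : R :=
  \sum_j f (del_tuple j a).

Lemma sum_del {R : pzRingType} {X : finType} {m : nat} (j : 'I_m.+1)
  (f : m.-tuple X -> R) :
  \sum_a f (del_tuple j a) = #|X|%:R * \sum_x f x.
Proof.
rewrite (sum_ins_tuple j) mulr_sumr.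
apply: eq_bigr => s _.
by under eq_bigr do rewrite ins_tupleK; rewrite sumr_const mulr_natl.
Qed.

(** The positions [j] and [lift j i] range over all ordered pairs of distinct
positions. *)
Lemma sum_del2 {R : pzRingType} {X : finType} {m : nat}
  (f : m.+1.-tuple X -> R) (j : 'I_m.+2) (i : 'I_m.+1) :
  \sum_a f (del_tuple j a) * f (del_tuple (lift j i) a) =
  \sum_s extension_sum f i s * extension_sum f (exch j i) s.
Proof.
rewrite (sum_ins_tuple j) (sum_ins_tuple i).
apply: eq_bigr => s _; rewrite mulr_suml; apply: eq_bigr => u _.
rewrite mulr_sumr; apply: eq_bigr => v _.
by rewrite ins_tupleK del_ins_ins.
Qed.

Lemma sum_deletion_sum {R : pzRingType} {X : finType} {m : nat}
  (f : m.-tuple X -> R) :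
  \sum_a deletion_sum f a = m.+1%:R * #|X|%:R * \sum_x f x.
Proof.
rewrite exchange_big /=; under eq_bigr do rewrite sum_del.
by rewrite sumr_const card_ord -[RHS]mulrA [RHS]mulr_natl.
Qed.

(** The first term comes from equal, the second from distinct positions of
deletion.  The squares [extension_sum f p s ^+ 2] account for the value that
[exch] takes twice. *)
Lemma sum_deletion_sum_sqr {R : pzRingType} {X : finType} {m : nat}
  (f : m.+1.-tuple X -> R) :
  \sum_a deletion_sum f a ^+ 2 = m.+2%:R * #|X|%:R * \sum_x f x ^+ 2 +
  \sum_s (\sum_p extension_sum f p s ^+ 2 + (\sum_p extension_sum f p s) ^+ 2).
Proof.
transitivity (\sum_(j < m.+2) (\sum_a f (del_tuple j a) ^+ 2 +
    \sum_(i < m.+1) \sum_a f (del_tuple j a) * f (del_tuple (lift j i) a))).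
  under eq_bigr do rewrite expr2 mulr_suml.
  rewrite exchange_big /=; apply: eq_bigr => j _.
  rewrite [X in _ = _ + X]exchange_big -big_split /=; apply: eq_bigr => a _.
  by rewrite [X in _ * X](bigD1_ord j) //= mulrDr -expr2 mulr_sumr.
rewrite big_split /=; congr (_ + _).
  under eq_bigr => j _ do rewrite (sum_del j (fun x => f x ^+ 2)).
  by rewrite sumr_const card_ord -[RHS]mulrA [RHS]mulr_natl.
rewrite exchange_big /=.
under eq_bigr => i _ do under eq_bigr => j _ do rewrite sum_del2.
under eq_bigr => i _ do rewrite exchange_big /=.
rewrite exchange_big /=; apply: eq_bigr => s _.
rewrite [X in _ = _ + X]expr2 mulr_suml -big_split /=; apply: eq_bigr => i _.
rewrite -mulr_sumr (sum_exch i (fun p => extension_sum f p s)).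
by rewrite mulrDr -expr2.
Qed.

(** Cauchy-Schwarz over the positions [p], and then over the words [s]. *)
Lemma sum_extension_sum_sqr_ge {R : realDomainType} {X : finType} {m : nat}
  (f : m.+1.-tuple X -> R) :
  m.+2%:R * m.+1%:R * (\sum_x f x) ^+ 2 <=
  (#|X| ^ m)%:R * \sum_s (\sum_p extension_sum f p s ^+ 2 +
                          (\sum_p extension_sum f p s) ^+ 2).
Proof.
set S := \sum_x f x; set T := \sum_s _.
have hS : \sum_s \sum_p extension_sum f p s = m.+1%:R * S.
  rewrite exchange_big /=.
  under eq_bigr => p _ do rewrite -(sum_ins_tuple p f).
  by rewrite sumr_const card_ord mulr_natl.
have hL := sqr_sum_le (fun s => \sum_p extension_sum f p s).
rewrite hS card_tuple in hL.
have hT : m.+2%:R * \sum_s (\sum_p extension_sum f p s) ^+ 2 <= m.+1%:R * T.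
  rewrite !mulr_sumr; apply: ler_sum => s _.
  have := sqr_sum_le (fun p => extension_sum f p s); rewrite card_ord => h.
  by rewrite mulrDr -[m.+2]addn1 natrD mulrDl mul1r addrC lerD2r.
rewrite -(ler_pM2l (ltr0Sn R m)).
have := ler_wpM2l (ler0n R (#|X| ^ m)) hT.
have := ler_wpM2l (ler0n R m.+2) hL.
lra.
Qed.

Lemma subseq_del {X : eqType} {m : nat} (x : m.-tuple X) (a : m.+1.-tuple X) :
  covers x a -> exists i, x = del_tuple i a.
Proof.
suff H (s t : seq X) : size t = (size s).+1 -> subseq s t ->
    exists2 i, (i <= size s)%N &
      forall x0 j, (j < size s)%N -> nth x0 s j = nth x0 t (bump i j).
  rewrite /covers => /H; rewrite !size_tuple => /(_ erefl) [i im hi].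
  have im' : (i < m.+1)%N by [].
  exists (Ordinal im'); apply: eq_from_tnth => j.
  rewrite tnth_mktuple (tnth_nth (tnth x j)) hi//.
  by rewrite [RHS](tnth_nth (tnth x j)).
elim: t s => [//|b t IH] [|c s] /= [hst].
  by move=> _; exists 0%N.
case: eqP => [->|_] sub.
  have [i hi h] := IH s hst sub.
  by exists i.+1 => // x0 [//|j] /= jj; rewrite h// bumpS.
have /eqP E : c :: s == t.
  by rewrite -(size_subseq_leqif sub).2 /= hst.
by exists 0%N => // x0 j _; rewrite E /bump leq0n.
Qed.

(** * The lower bound for every alphabet *)

Lemma card_covering_ge {X : finType} {r : nat} (C : {set r.-tuple X}) :
  (0 < r)%N -> covering_insertion_code r.+1 C -> (#|X| ^ r <= r * #|C|)%N.
Proof.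
case: r C => [//|m] C _ /forallP covC.
pose f (x : m.+1.-tuple X) : int := (x \notin C)%:R.
have f01 x : 0 <= f x <= 1 by rewrite /f; case: (_ \notin _).
have fsq x : f x ^+ 2 = f x by rewrite /f; case: (_ \notin _).
have sumf : \sum_x f x + #|C|%:R = (#|X| ^ m.+1)%:R.
  rewrite /f -card_tuple -(cardC C) natrD addrC; congr (_ + _).
  rewrite -sum1_card natr_sum [RHS]big_mkcond /=; apply: eq_bigr => x _.
  by rewrite !inE; case: (x \in C).
have w0 a : 0 <= deletion_sum f a.
  by apply: sumr_ge0 => j _; case/andP: (f01 (del_tuple j a)).
(* One of the [m + 2] deletions of [a] belongs to [C], so at most [m + 1] of
   them count. *)
have wm a : deletion_sum f a <= m.+1%:R.
  have /existsP[x /andP[xC /subseq_del[i xE]]] := covC a.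
  rewrite /deletion_sum (bigD1_ord i) //= -xE /f xC add0r.
  rewrite -[X in _ <= X%:R]card_ord -sum1_card natr_sum; apply: ler_sum => j _.
  by case/andP: (f01 (del_tuple (lift i j) a)).
have wsq : \sum_a deletion_sum f a ^+ 2 <= m.+1%:R * \sum_a deletion_sum f a.
  rewrite mulr_sumr; apply: ler_sum => a _; rewrite expr2.
  exact: ler_wpM2r.
rewrite sum_deletion_sum_sqr sum_deletion_sum in wsq.
rewrite (eq_bigr f (fun x _ => fsq x)) in wsq.
have hT := sum_extension_sum_sqr_ge f.
move: sumf wsq hT.
set S := \sum_x f x; set T := \sum_s _; set M := (#|X| ^ m)%N.
rewrite expnS natrM -/M => sumf wsq hT.
have S0 : 0 <= S by apply: sumr_ge0 => x _; case/andP: (f01 x).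
rewrite -(ler_nat int) !natrM -/M.
(* Multiplying by [M], the inequality is later divided by [S], the size of the
   complement of [C]; the case [S = 0] is immediate. *)
have wsqM := ler_wpM2l (ler0n int M) wsq.
have hS : m.+1%:R * S ^+ 2 <= m%:R * (#|X|%:R * M%:R) * S.
  rewrite -(ler_pM2l (ltr0Sn int m.+1)).
  rewrite -[m.+2]addn2 -[m.+1]addn1 !natrD in hT wsqM *.
  lra.
have [S_eq0|S_neq0] := eqVneq S 0.
  rewrite S_eq0 add0r in sumf; rewrite -sumf.
  by rewrite -[X in X <= _]mul1r ler_wpM2r// ler1n.
have Spos : 0 < S by rewrite lt_neqAle eq_sym S_neq0.
rewrite expr2 mulrA ler_pM2r// -[m.+1]addn1 natrD in hS.
move: (#|C|%:R : int) sumf => c sumf.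
have SE : S = #|X|%:R * M%:R - c by rewrite -sumf addrK.
rewrite -[m.+1]addn1 natrD; rewrite SE in hS.
lra.
Qed.

Lemma min_code_size_ge (n : nat) {r : nat} :
  (0 < r)%N -> (n ^ r <= r * min_code_size n r.+1 r)%N.
Proof.
move=> r0; have [[C covC <-] _] := min_code_sizeP n (leqnSn r).
by have := card_covering_ge C r0 covC; rewrite card_ord.
Qed.

(** * Existence of the limit *)

(** The inverse image of a covering code under a map of alphabets [Y -> X], the
first component of [h], is a covering code; [Z] labels the letters within each
fibre of that map. *)
Lemma covering_pullback {X Y Z : finType} {k r : nat} (h : Y -> X * Z)
  (C : {set r.-tuple X}) : injective h -> covering_insertion_code k C ->
  exists2 D : {set r.-tuple Y}, covering_insertion_code k D &
    (#|D| <= #|C| * #|Z| ^ r)%N.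
Proof.
move=> inj_h /forallP covC; pose h1 y := (h y).1; pose h2 y := (h y).2.
pose D := [set y : r.-tuple Y | [tuple of map h1 y] \in C].
exists D.
  apply/forallP => b.
  have /existsP[x /andP[xC xb]] := covC [tuple of map h1 b].
  have /subseqP[msk szm xE] : subseq x (map h1 b) by [].
  have szy : size (mask msk b) == r.
    by rewrite -(size_map h1) map_mask -xE size_tuple.
  apply/existsP; exists (Tuple szy); rewrite /covers /= mask_subseq andbT.
  rewrite inE; suff -> : [tuple of map h1 (Tuple szy)] = x by [].
  by apply: val_inj; rewrite /= map_mask.
pose g (y : r.-tuple Y) := ([tuple of map h1 y], [tuple of map h2 y]).
have inj_g : injective g.
  move=> y y' gE.
  apply: eq_from_tnth => i; apply: inj_h.
  have E1 := congr1 (fun p => tnth p.1 i) gE.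
  have E2 := congr1 (fun p => tnth p.2 i) gE.
  rewrite /= !tnth_map in E1 E2.
  rewrite [LHS]surjective_pairing [RHS]surjective_pairing.
  by rewrite [(h _).1]E1 [(h _).2]E2.
rewrite -(card_imset _ inj_g) -card_tuple -cardsT -cardsX.
apply: subset_leq_card; apply/fintype.subsetP => _ /imsetP[y yD ->].
by rewrite inE /= finset.in_setT andbT; rewrite inE in yD.
Qed.

Lemma min_code_size_blowup {n N q k r : nat} : (r <= k)%N ->
  (0 < q)%N -> (N <= n * q)%N ->
  (min_code_size N k r <= min_code_size n k r * q ^ r)%N.
Proof.
move=> rk q0 Nnq; have [[C covC <-] _] := min_code_sizeP n rk.
have [_ minN] := min_code_sizeP N rk.
have ltn (i : 'I_N) : (i %/ q < n)%N.
  by rewrite ltn_divLR// (leq_trans (ltn_ord i)).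
have ltq (i : 'I_N) : (i %% q < q)%N by rewrite ltn_pmod.
pose h (i : 'I_N) := (Ordinal (ltn i), Ordinal (ltq i)).
have inj_h : injective h.
  move=> i j [e1 e2]; apply: val_inj => /=.
  by rewrite (divn_eq i q) e1 e2 -divn_eq.
have [D /minN minD leD] := covering_pullback _ _ inj_h covC.
by rewrite (leq_trans minD)// (leq_trans leD)// card_ord.
Qed.

(** The limit is the infimum of the [u n] with [0 < n]. *)
Lemma cvg_of_blowup_bound {R : realType} (r : nat) (u : nat -> R) :
  (forall n, 0 <= u n) ->
  (forall n N : nat, (0 < n)%N -> (0 < N)%N ->
    u N <= u n * (1 + n%:R / N%:R) ^+ r) ->
  cvgn u.
Proof.
move=> u0 uN.
pose A := [set u n | n in [set n | (0 < n)%N]]%classic.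
have hA : has_inf A.
  split; first by exists (u 1%N); exists 1%N.
  by exists 0 => _ [n _ <-].
apply/cvg_ex; exists (inf A); apply/cvgrPdist_le => /= e e0.
have [_ [n /= n0 <-] un] := inf_adherent e0 hA.
have cv : ((fun N => u n * (1 + n%:R / N%:R) ^+ r) @ \oo -->
           u n * (1 + n%:R * 0) ^+ r)%classic.
  apply: cvgM; first exact: cvg_cst.
  apply: (cvg_comp (fun N : nat => 1 + n%:R / N%:R) (fun x => x ^+ r));
    last exact: exprn_continuous.
  apply: cvgD; first exact: cvg_cst.
  apply: cvgM; first exact: cvg_cst.
  apply/gtr0_cvgV0; last exact: cvgr_idn.
  by near=> N; rewrite ltr0n; near: N; exact: nbhs_infty_gt.
rewrite mulr0 addr0 expr1n mulr1 in cv.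
have ev : (\forall N \near \oo,
  u n * (1 + n%:R / N%:R) ^+ r < inf A + e)%classic.
  by apply: cvgr_lt un; exact: cv.
near=> N.
have N0 : (0 < N)%N by near: N; exact: nbhs_infty_gt.
have h1 : u N <= u n * (1 + n%:R / N%:R) ^+ r by exact: uN.
have h2 : u n * (1 + n%:R / N%:R) ^+ r < inf A + e by near: N.
have h3 : inf A <= u N by apply: ge_inf; [exact: hA.2 | exists N].
by rewrite distrC ger0_norm; lra.
Unshelve. all: by end_near. Qed.

Theorem theorem7 (R : realType) (r : nat) (hr : (0 < r)%N) :
  code_density R r.+1 r >= 1 / r%:R.
Proof.
pose u n : R := (min_code_size n r.+1 r)%:R / n%:R ^+ r.
have cv : cvgn u.
  apply: (@cvg_of_blowup_bound _ r) => [n|n N n0 N0].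
    by rewrite divr_ge0// exprn_ge0.
  (* [q] is at least the ceiling of [N / n], and at most [N / n + 1]. *)
  rewrite /u; set q := (N %/ n).+1.
  have Nq : (N <= n * q)%N by rewrite mulnC ltnW// -ltn_divLR.
  have hq : (n%:R * q%:R / N%:R : R) <= 1 + n%:R / N%:R.
    rewrite -[X in X + _](@divff _ N%:R) ?pnatr_eq0 -?lt0n// -mulrDl.
    rewrite ler_pM2r ?invr_gt0 ?ltr0n// -natrM -natrD ler_nat /q mulnS addnC.
    by rewrite leq_add2r mulnC leq_divM.
  have nR0 : (n%:R : R) != 0 by rewrite pnatr_eq0 -lt0n.
  apply: (@le_trans _ _ ((min_code_size n r.+1 r)%:R / n%:R ^+ r *
      (n%:R * q%:R / N%:R) ^+ r)).
    rewrite !exprMn mulrA mulrA exprVn mulfVK ?expf_neq0//.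
    rewrite ler_pM2r ?invr_gt0 ?exprn_gt0 ?ltr0n// -natrX -natrM ler_nat.
    exact: min_code_size_blowup.
  apply: ler_wpM2l; first by rewrite divr_ge0// exprn_ge0.
  by rewrite lerXn2r ?nnegrE ?divr_ge0 ?mulr_ge0 ?addr_ge0 ?divr_ge0.
apply: limr_ge => //; near=> n.
have n0 : (0 < n)%N by near: n; exact: nbhs_infty_gt.
rewrite /u ler_pdivrMr ?ltr0n// mulrAC ler_pdivlMr ?exprn_gt0 ?ltr0n//.
by rewrite mul1r -natrX -natrM ler_nat mulnC min_code_size_ge.
Unshelve. all: by end_near. Qed.
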